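(* Let $X, Y$ be (possibly infinite) metric spaces and let $\epsilon \ge 0$ be real. For each $\epsilon$-isometry $\eta : X \to Y$ there is a $4\epsilon$-ml-isomorphism $\kappa : \mathrm{Lip}\,Y \to \mathrm{Lip}\,X$ such that $\kappa$ is $\epsilon$-near $f \mapsto f\circ\eta$, i.e. $\sup_{x\in X} |(\kappa f)(x) - f(\eta(x))| \le \epsilon$ for all $f \in \mathrm{Lip}\,Y$.
   Context: Let $Z = \mathbb{R}_{\ge 0}\cup\{\infty\}$ with $\infty + z = z+\infty = \infty$ and $z \le \infty$ for all $z\in Z$. A (possibly infinite) metric space is a non-empty set $X$ with a symmetric map $d : X\times X \to Z$ that is positive-definite ($d(x,y)=0$ iff $x=y$) and satisfies the triangle inequality. For $a,b,z \in Z$, $|a-b|\le z$ means $a \le b+z$ and $b \le a+z$; thus $|\infty-\infty| = 0$ and $|\infty - a| = \infty$ for finite $a$, and $|a-b|$ is a (possibly infinite) metric on $Z$. All metrics are denoted $d$. $\mathrm{Lip}\,X$ is the set of all $f: X\to Z$ with $|f(x)-f(y)| \le d(x,y)$ for all $x,y\in X$. It carries the (possibly infinite) metric $d_\infty(f,g) = \sup_{x\in X}|f(x)-g(x)|$ and the pointwise supremum $\bigvee$ and infimum $\bigwedge$ of arbitrary families (these stay in $\mathrm{Lip}\,X$), with $\bigvee_\emptyset = 0$ and $\bigwedge_\emptyset = \infty$ (constant functions). For real $\epsilon\ge 0$ and (possibly infinite) metric spaces $A,B$: two maps $\alpha,\beta:A\to B$ are $\epsilon$-near if $d(\alpha a,\beta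 a)\le\epsilon$ for all $a\in A$. A (not necessarily continuous) map $\eta : A\to B$ is an $\epsilon$-isometric embedding if $|d(a,a') - d(\eta a,\eta a')|\le \epsilon$ for all $a,a'\in A$. An $\epsilon$-isometry is a pair of $\epsilon$-isometric embeddings $\eta:A\to B$, $\eta':B\to A$ such that $\eta\circ\eta'$ and $\eta'\circ\eta$ are $\epsilon$-near the respective identities; when one speaks of an $\epsilon$-isometry $\eta:A\to B$, a corresponding $\eta'$ is implied. An $\epsilon$-ml-homomorphism is an $\epsilon$-isometric embedding $\kappa:\mathrm{Lip}\,Y\to\mathrm{Lip}\,X$ (for the metrics $d_\infty$) such that $d_\infty(\bigvee_{j\in J}\kappa f_j, \kappa\bigvee_{j\in J} f_j)\le\epsilon$ and $d_\infty(\bigwedge_{j\in J}\kappa f_j, \kappa\bigwedge_{j\in J} f_j)\le\epsilon$ for every family $(f_j)_{j\in J}$ in $\mathrm{Lip}\,Y$ over any index set $J$ (including $J=\emptyset$). An $\epsilon$-ml-isomorphism is a pair of $\epsilon$-ml-homomorphisms $\kappa:\mathrm{Lip}\,Y\to\mathrm{Lip}\,X$, $\kappa':\mathrm{Lip}\,X\to\mathrm{Lip}\,Y$ such that $\kappa\circ\kappa'$ and $\kappa'\circ\kappa$ are $\epsilon$-near the respective identities; when one speaks of an $\epsilon$-ml-isomorphism $\kappa$, a corresponding $\kappa'$ is implied. *)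

(* Defs.v *)
(* Values in [0, +oo] are represented by nonnegative elements of \bar R. *)
From mathcomp Require Import all_boot all_order all_algebra.
From mathcomp Require Import boolp classical_sets reals constructive_ereal ereal.

Set Implicit Arguments.
Unset Strict Implicit.
Unset Printing Implicit Defensive.

Import Order.TTheory GRing.Theory Num.Theory.

Local Open Scope classical_set_scope.
Local Open Scope ring_scope.
Local Open Scope ereal_scope.

(* In \bar R, +oo - +oo = -oo and so `|+oo - +oo| = +oo; the case split
   restores |oo - oo| = 0. *)
Definition absdiff (R : realType) (a b : \bar R) : \bar R :=
  if a == b then 0 else `|a - b|.

Lemma absdiff_ge0 (R : realType) (a b : \bar R) : 0 <= absdiff a b.
Proof. by rewrite /absdiff; case: eqP => // _; exact: abse_ge0. Qed.

Lemma absdiff_leP (R : realType) (a b z : \bar R) :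
  0 <= a -> 0 <= b -> 0 <= z ->
  absdiff a b <= z <-> a <= b + z /\ b <= a + z.
Proof.
rewrite /absdiff; case: eqP => [<- a0 _ z0|].
  by split => // _; rewrite leeDl.
case: a b z => [a| |] [b| |] [z| |] //= neq a0 b0 z0.
- rewrite !lee_fin ler_distlC lerBlDr.
  by split => [/andP[]|[-> ->]].
- by split => // _; rewrite !leey.
- by split => // -[].
- by split => // _; rewrite !leey.
- by split => // -[].
- by split => // _; rewrite !leey.
Qed.

Lemma absdiffxx (R : realType) (a : \bar R) : absdiff a a = 0.
Proof. by rewrite /absdiff eqxx. Qed.

Lemma absdiffC (R : realType) (a b : \bar R) :
  0 <= a -> 0 <= b -> absdiff a b = absdiff b a.
Proof.
move=> a0 b0; apply/eqP; rewrite eq_le; apply/andP.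
split; apply/absdiff_leP => //; rewrite ?absdiff_ge0 //; apply/and_comm;
  by apply/absdiff_leP; rewrite ?absdiff_ge0.
Qed.

Lemma absdiff_eq0 (R : realType) (a b : \bar R) :
  0 <= a -> 0 <= b -> absdiff a b <= 0 -> a = b.
Proof.
move=> a0 b0 /absdiff_leP => /(_ a0 b0 (lexx _)); rewrite !adde0 => -[ab ba].
by apply/eqP; rewrite eq_le ab ba.
Qed.

Lemma absdiff_triangle (R : realType) (a b c : \bar R) :
  0 <= a -> 0 <= b -> 0 <= c ->
  absdiff a c <= absdiff a b + absdiff b c.
Proof.
move=> a0 b0 c0; apply/absdiff_leP; rewrite ?adde_ge0 ?absdiff_ge0 //.
have /absdiff_leP [] // := lexx (absdiff a b); rewrite ?absdiff_ge0 // => ab ba.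
have /absdiff_leP [] // := lexx (absdiff b c); rewrite ?absdiff_ge0 // => bc cb.
split.
  by apply: (le_trans ab); rewrite [absdiff a b + absdiff b c]addeC addeA leeD2r.
by apply: (le_trans cb); rewrite addeA leeD2r.
Qed.

(* Metric spaces with possibly infinite distances; the library's metric
   structures only allow finite ones. *)
Record emetricSpace (R : realType) := EMetricSpace {
  emetric_sort :> Type;
  emetric_dist : emetric_sort -> emetric_sort -> \bar R;
  emetric_inhabited : inhabited emetric_sort;
  emetric_ge0 : forall x y, 0 <= emetric_dist x y;
  emetric_eq0 : forall x y, emetric_dist x y = 0 <-> x = y;
  emetric_sym : forall x y, emetric_dist x y = emetric_dist y x;
  emetric_triangle : forall x y z,
    emetric_dist x z <= emetric_dist x y + emetric_dist y z }.

Arguments emetric_dist {R e} : rename.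

Record Lip (R : realType) (X : emetricSpace R) := MkLip {
  lip_fun :> X -> \bar R;
  lip_ge0 : forall x, 0 <= lip_fun x;
  lip_lip : forall x y, absdiff (lip_fun x) (lip_fun y) <= emetric_dist x y }.

Definition lip_dist (R : realType) (X : emetricSpace R) (f g : Lip X) : \bar R :=
  ereal_sup (range (fun x => absdiff (f x) (g x))).

Lemma lip_le (R : realType) (X : emetricSpace R) (f : Lip X) (x y : X) :
  f x <= f y + emetric_dist x y.
Proof.
by have /absdiff_leP[] := lip_lip f x y; rewrite ?lip_ge0 ?emetric_ge0.
Qed.

Lemma mk_lip_lip (R : realType) (X : emetricSpace R) (f : X -> \bar R) :
  (forall x, 0 <= f x) -> (forall x y, f x <= f y + emetric_dist x y) ->
  forall x y, absdiff (f x) (f y) <= emetric_dist x y.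
Proof.
move=> f0 fl x y; apply/absdiff_leP; rewrite ?emetric_ge0 //; split => //.
by rewrite emetric_sym.
Qed.

Lemma lip_ext (R : realType) (X : emetricSpace R) (f g : Lip X) :
  (forall x, f x = g x) -> f = g.
Proof.
case: f g => [f f0 fl] [g g0 gl] /= /funext fg; subst g.
by congr MkLip; exact: Prop_irrelevance.
Qed.

Section LipMetric.
Variables (R : realType) (X : emetricSpace R).
Implicit Types f g h : Lip X.

Lemma lip_dist_ub f g x : absdiff (f x) (g x) <= lip_dist f g.
Proof. by apply: ereal_sup_ubound; exists x. Qed.

Lemma lip_dist_ge0 f g : 0 <= lip_dist f g.
Proof.
case: (emetric_inhabited X) => x.
exact: le_trans (absdiff_ge0 _ _) (lip_dist_ub f g x).
Qed.

Lemma lip_dist_eq0 f g : lip_dist f g = 0 <-> f = g.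
Proof.
split=> [fg0|->].
  apply: lip_ext => x; apply: absdiff_eq0; rewrite ?lip_ge0 //.
  by rewrite -fg0 lip_dist_ub.
apply/eqP; rewrite eq_le lip_dist_ge0 andbT.
by apply: ge_ereal_sup => _ [x _ <-]; rewrite absdiffxx.
Qed.

Lemma lip_dist_sym f g : lip_dist f g = lip_dist g f.
Proof.
rewrite /lip_dist (_ : (fun x => _) = fun x => absdiff (g x) (f x)) //.
by apply/funext => x; rewrite absdiffC ?lip_ge0.
Qed.

Lemma lip_dist_triangle f g h : lip_dist f h <= lip_dist f g + lip_dist g h.
Proof.
apply: ge_ereal_sup => _ [x _ <-].
apply: le_trans (absdiff_triangle (lip_ge0 f x) (lip_ge0 g x) (lip_ge0 h x)) _.
by rewrite leeD ?lip_dist_ub.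
Qed.

Lemma lip_inhabited : inhabited (Lip X).
Proof.
have lip0 (x y : X) : absdiff (0 : \bar R) 0 <= emetric_dist x y.
  by rewrite absdiffxx emetric_ge0.
exact: inhabits (@MkLip _ X (fun=> 0) (fun=> lexx 0) lip0).
Qed.

Canonical Lip_emetricSpace : emetricSpace R :=
  EMetricSpace lip_inhabited lip_dist_ge0 lip_dist_eq0 lip_dist_sym
    lip_dist_triangle.

End LipMetric.

Section LipLattice.
Variables (R : realType) (X : emetricSpace R) (J : Type) (F : J -> Lip X).

(* The supremum is taken in [0, +oo]: adjoining 0 makes the empty supremum 0
   instead of -oo and changes nothing otherwise. *)
Definition lip_sup_fun (x : X) : \bar R :=
  ereal_sup (0 |` range (fun j => F j x)).

Definition lip_inf_fun (x : X) : \bar R :=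
  ereal_inf (range (fun j => F j x)).

Lemma lip_sup_ge0 x : 0 <= lip_sup_fun x.
Proof. by apply: ereal_sup_ubound; left. Qed.

Lemma lip_sup_lip x y :
  absdiff (lip_sup_fun x) (lip_sup_fun y) <= emetric_dist x y.
Proof.
apply: (mk_lip_lip lip_sup_ge0) => {}x {}y.
apply: ge_ereal_sup => _ [->|[j _ <-]].
  by rewrite adde_ge0 ?lip_sup_ge0 ?emetric_ge0.
apply: (le_trans (lip_le (F j) x y)); rewrite leeD2r //.
by apply: ereal_sup_ubound; right; exists j.
Qed.

Lemma lip_inf_ge0 x : 0 <= lip_inf_fun x.
Proof. by apply: le_ereal_inf_tmp => _ [j _ <-]; exact: lip_ge0. Qed.

Lemma lip_inf_lip x y :
  absdiff (lip_inf_fun x) (lip_inf_fun y) <= emetric_dist x y.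
Proof.
apply: (mk_lip_lip lip_inf_ge0) => {}x {}y.
case dxy : (emetric_dist x y) (emetric_ge0 x y) => [r| |] // r0; last first.
  by rewrite addey ?leey // gt_eqF // (lt_le_trans _ (lip_inf_ge0 _)).
rewrite -leeBlDr //; apply: le_ereal_inf_tmp => _ [j _ <-].
rewrite leeBlDr // -dxy; apply: (le_trans _ (lip_le (F j) x y)).
by apply: ereal_inf_lbound; exists j.
Qed.

Definition lip_sup : Lip X := MkLip lip_sup_ge0 lip_sup_lip.
Definition lip_inf : Lip X := MkLip lip_inf_ge0 lip_inf_lip.

End LipLattice.

Definition eps_near (R : realType) (e : R) (A : Type) (B : emetricSpace R)
    (alpha beta : A -> B) : Prop :=
  forall a, emetric_dist (alpha a) (beta a) <= e%:E.

Definition eps_isometric_embedding (R : realType) (e : R)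
    (A B : emetricSpace R) (eta : A -> B) : Prop :=
  forall a a',
    absdiff (emetric_dist a a') (emetric_dist (eta a) (eta a')) <= e%:E.

Definition eps_isometry (R : realType) (e : R) (A B : emetricSpace R)
    (eta : A -> B) (eta' : B -> A) : Prop :=
  [/\ eps_isometric_embedding e eta, eps_isometric_embedding e eta',
      eps_near e (eta \o eta') id & eps_near e (eta' \o eta) id].

Definition eps_ml_homomorphism (R : realType) (e : R) (X Y : emetricSpace R)
    (kappa : Lip Y -> Lip X) : Prop :=
  [/\ eps_isometric_embedding e kappa,
      forall (J : Type) (f : J -> Lip Y),
        emetric_dist (lip_sup (kappa \o f)) (kappa (lip_sup f)) <= e%:E &
      forall (J : Type) (f : J -> Lip Y),
        emetric_dist (lip_inf (kappa \o f)) (kappa (lip_inf f)) <= e%:E].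

Definition eps_ml_isomorphism (R : realType) (e : R) (X Y : emetricSpace R)
    (kappa : Lip Y -> Lip X) (kappa' : Lip X -> Lip Y) : Prop :=
  [/\ eps_ml_homomorphism e kappa, eps_ml_homomorphism e kappa',
      eps_near e (kappa \o kappa') id & eps_near e (kappa' \o kappa) id].

(* Main.v *)
Require Import Defs.
From mathcomp Require Import all_boot all_order all_algebra.
From mathcomp Require Import boolp classical_sets reals constructive_ereal ereal.
From mathcomp Require Import lra.

(** Composition with an [eps]-isometry [eta : X -> Y] almost does the job, but
    for [f] in [Lip Y] the function [f \o eta] is only Lipschitz up to an
    additive error: [f (eta x) <= f (eta x') + d x x' + eps].  Its largest
    1-Lipschitz minorant [x |-> inf_x' (f (eta x') + d x x')] lies between
    [f \o eta - eps] and [f \o eta], so taking it as [kappa f] repairs the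
    defect at the cost of [eps] ([lip_envelope_near]).

    Everything else follows from this nearness alone.  Precomposition commutes
    with pointwise suprema and infima, and these are 1-Lipschitz for the uniform
    distance, so [kappa] commutes with them up to [2 eps].  Since
    [eta \o eta'] is [eps]-near the identity and [f] is 1-Lipschitz, the value
    [f y] is recovered from [kappa f] at [eta' y] up to [2 eps]; hence
    [kappa] distorts distances by at most [4 eps]
    ([near_precomp_ml_homomorphism]), and a [kappa'] built in the same way from
    [eta'] inverts [kappa] up to [3 eps] ([near_precomp_cancel]). *)

Set Implicit Arguments.
Unset Strict Implicit.
Unset Printing Implicit Defensive.

Import Order.TTheory GRing.Theory Num.Theory.

Local Open Scope classical_set_scope.
Local Open Scope ring_scope.
Local Open Scope ereal_scope.

Section AbsDiff.
Variable R : realType.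
Implicit Types a b c r s z : \bar R.

Lemma absdiff_le_trans b a c r s : 0 <= a -> 0 <= b -> 0 <= c ->
  absdiff a b <= r -> absdiff b c <= s -> absdiff a c <= r + s.
Proof.
move=> a0 b0 c0 ab bc.
exact: le_trans (absdiff_triangle a0 b0 c0) (leeD ab bc).
Qed.

Lemma le_ereal_infD (J : Type) (F : J -> \bar R) a z :
  (forall j, 0 <= F j) -> 0 <= z -> (forall j, a <= F j + z) ->
  a <= ereal_inf (range F) + z.
Proof.
move=> F0 z0 aF.
have inf0 : 0 <= ereal_inf (range F).
  by apply: le_ereal_inf_tmp => _ [j _ <-]; exact: F0.
(* For finite [z] subtract it from both sides; for [z = +oo] the right-hand
   side is [+oo] because the infimum is not [-oo]. *)
case: z z0 aF => [r| |] // z0 aF; last first.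
  by rewrite addey ?leey // gt_eqF // (lt_le_trans _ inf0).
rewrite -leeBlDr //; apply: le_ereal_inf_tmp => _ [j _ <-].
by rewrite leeBlDr.
Qed.

Lemma absdiff_ereal_inf (J : Type) (F G : J -> \bar R) z :
  (forall j, 0 <= F j) -> (forall j, 0 <= G j) -> 0 <= z ->
  (forall j, absdiff (F j) (G j) <= z) ->
  absdiff (ereal_inf (range F)) (ereal_inf (range G)) <= z.
Proof.
move=> F0 G0 z0 FG.
have FGz j : F j <= G j + z /\ G j <= F j + z by exact/absdiff_leP.
apply/absdiff_leP => //; try by apply: le_ereal_inf_tmp => _ [j _ <-].
split; apply: le_ereal_infD => // j.
  by apply: le_trans (FGz j).1; apply: ereal_inf_lbound; exists j.
by apply: le_trans (FGz j).2; apply: ereal_inf_lbound; exists j.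
Qed.

Lemma absdiff_ereal_sup (J : Type) (F G : J -> \bar R) z :
  (forall j, 0 <= F j) -> (forall j, 0 <= G j) -> 0 <= z ->
  (forall j, absdiff (F j) (G j) <= z) ->
  absdiff (ereal_sup (0 |` range F)) (ereal_sup (0 |` range G)) <= z.
Proof.
move=> F0 G0 z0 FG.
have FGz j : F j <= G j + z /\ G j <= F j + z by exact/absdiff_leP.
have sup0 (H : J -> \bar R) : 0 <= ereal_sup (0 |` range H).
  by apply: ereal_sup_ubound; left.
apply/absdiff_leP => //.
split; apply: ge_ereal_sup => _ [->|[j _ <-]]; rewrite ?adde_ge0 //.
  apply: le_trans (FGz j).1 _; rewrite leeD2r //.
  by apply: ereal_sup_ubound; right; exists j.
apply: le_trans (FGz j).2 _; rewrite leeD2r //.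
by apply: ereal_sup_ubound; right; exists j.
Qed.

End AbsDiff.

Lemma lip_dist_leP (R : realType) (X : emetricSpace R) (f g : Lip X) z :
  (forall x, absdiff (f x) (g x) <= z) -> lip_dist f g <= z.
Proof. by move=> fg; apply: ge_ereal_sup => _ [x _ <-]. Qed.

Section Envelope.
Variables (R : realType) (X : emetricSpace R).

Section Cone.
Variables (a : \bar R) (a0 : 0 <= a) (x0 : X).

Lemma cone_ge0 x : 0 <= a + emetric_dist x x0.
Proof. by rewrite adde_ge0 ?emetric_ge0. Qed.

Lemma cone_lip x y :
  absdiff (a + emetric_dist x x0) (a + emetric_dist y x0) <= emetric_dist x y.
Proof.
apply: (mk_lip_lip cone_ge0) => {}x {}y.
by rewrite -addeA leeD2l // addeC emetric_triangle.
Qed.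

Definition lip_cone : Lip X := MkLip cone_ge0 cone_lip.

End Cone.

(** The largest 1-Lipschitz minorant of [g]; writing it as an infimum of cones
    makes it an element of [Lip X] by the lattice structure. *)
Definition lip_envelope (g : X -> \bar R) (g0 : forall x, 0 <= g x) : Lip X :=
  lip_inf (fun x' => lip_cone (g0 x') x').

(** The vertex of the cone at [x] gives the upper bound [g x]; the
    almost-Lipschitz condition says that no cone passes more than [e] below
    [g]. *)
Lemma lip_envelope_near (g : X -> \bar R) (g0 : forall x, 0 <= g x) (e : R) :
  (0 <= e)%R ->
  (forall x x', g x <= g x' + emetric_dist x x' + e%:E) ->
  forall x, absdiff (lip_envelope g0 x) (g x) <= e%:E.
Proof.
move=> e0 ge x; apply/absdiff_leP; rewrite ?lip_ge0 ?lee_fin //; split.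
  apply: (@le_trans _ _ (g x)); last by rewrite leeDl // lee_fin.
  apply: ereal_inf_lbound; exists x => //=.
  by rewrite (proj2 (emetric_eq0 x x) erefl) adde0.
by apply: le_ereal_infD => [x'||x'] /=; rewrite ?lee_fin ?cone_ge0.
Qed.

End Envelope.

Section NearPrecomposition.
Variables (R : realType) (X Y : emetricSpace R) (e : R).
Hypothesis e0 : (0 <= e)%R.
Variables (eta : X -> Y) (eta' : Y -> X) (kappa : Lip Y -> Lip X).
Hypothesis etaK : eps_near e (eta \o eta') id.
Hypothesis kappa_near : forall (f : Lip Y) x,
  absdiff (kappa f x) (f (eta x)) <= e%:E.

Let kappa_nearC (f : Lip Y) x : absdiff (f (eta x)) (kappa f x) <= e%:E.
Proof. by rewrite absdiffC ?lip_ge0. Qed.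

(** One [e] pays for replacing [kappa f] by [f \o eta], the other for moving
    from [eta (eta' y)] to [y]. *)
Lemma near_precomp_recover (f : Lip Y) y :
  absdiff (kappa f (eta' y)) (f y) <= e%:E + e%:E.
Proof.
apply: absdiff_le_trans (kappa_near _ _) _; rewrite ?lip_ge0 //.
exact: le_trans (lip_lip _ _ _) (etaK y).
Qed.

Lemma near_precomp_dist_le f g :
  lip_dist (kappa f) (kappa g) <= lip_dist f g + (4 * e)%:E.
Proof.
apply: lip_dist_leP => x.
apply: le_trans (_ : e%:E + (lip_dist f g + e%:E) <= _); last first.
  by rewrite addeCA leeD2l // -!EFinD lee_fin; move: e0; lra.
apply: absdiff_le_trans (kappa_near _ _) _; rewrite ?lip_ge0 //.
by apply: absdiff_le_trans (lip_dist_ub _ _ _) (kappa_nearC _ _);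
  rewrite ?lip_ge0.
Qed.

Lemma near_precomp_dist_ge f g :
  lip_dist f g <= lip_dist (kappa f) (kappa g) + (4 * e)%:E.
Proof.
apply: lip_dist_leP => y.
have -> : (4 * e)%:E = (e%:E + e%:E) + (e%:E + e%:E).
  by rewrite -!EFinD; congr EFin; move: e0; lra.
rewrite addeCA.
apply: (@absdiff_le_trans _ (kappa f (eta' y))); rewrite ?lip_ge0 //.
  by rewrite absdiffC ?lip_ge0 ?near_precomp_recover.
apply: absdiff_le_trans (lip_dist_ub _ _ _) (near_precomp_recover _ _);
  by rewrite ?lip_ge0.
Qed.

Lemma near_precomp_sup (J : Type) (f : J -> Lip Y) :
  lip_dist (lip_sup (kappa \o f)) (kappa (lip_sup f)) <= e%:E + e%:E.
Proof.
apply: lip_dist_leP => x.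
apply: absdiff_le_trans (kappa_nearC _ _); rewrite ?lip_ge0 //.
apply: absdiff_ereal_sup => *; rewrite ?lip_ge0 ?lee_fin //.
exact: kappa_near.
Qed.

Lemma near_precomp_inf (J : Type) (f : J -> Lip Y) :
  lip_dist (lip_inf (kappa \o f)) (kappa (lip_inf f)) <= e%:E + e%:E.
Proof.
apply: lip_dist_leP => x.
apply: absdiff_le_trans (kappa_nearC _ _); rewrite ?lip_ge0 //.
apply: absdiff_ereal_inf => *; rewrite ?lip_ge0 ?lee_fin //.
exact: kappa_near.
Qed.

(** The right inverse [eta'] makes [eta] almost surjective, so that [f] is
    determined by [f \o eta] up to a bounded error; this gives the lower bound
    on distances.  The upper bound and the lattice operations rest on [kappa]
    being near precomposition, which never increases distances and commutes
    with suprema and infima. *)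
Lemma near_precomp_ml_homomorphism : eps_ml_homomorphism (4 * e)%R kappa.
Proof.
have e2_le4 : e%:E + e%:E <= (4 * e)%:E by rewrite -EFinD lee_fin; move: e0; lra.
split=> [f g|J f|J f] /=.
- apply/absdiff_leP; rewrite ?lip_dist_ge0 ?lee_fin ?mulr_ge0 //.
  by split; [exact: near_precomp_dist_ge|exact: near_precomp_dist_le].
- exact: le_trans (near_precomp_sup f) e2_le4.
- exact: le_trans (near_precomp_inf f) e2_le4.
Qed.

Lemma near_precomp_cancel (kappa' : Lip X -> Lip Y) :
  (forall (g : Lip X) y, absdiff (kappa' g y) (g (eta' y)) <= e%:E) ->
  eps_near (4 * e)%R (kappa' \o kappa) id.
Proof.
move=> kappa'_near f; apply: lip_dist_leP => y /=.
apply: le_trans (_ : e%:E + (e%:E + e%:E) <= _); last first.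
  by rewrite -!EFinD lee_fin; move: e0; lra.
apply: absdiff_le_trans (kappa'_near _ _) (near_precomp_recover _ _);
  by rewrite ?lip_ge0.
Qed.

End NearPrecomposition.

Lemma exists_lip_near_precomp (R : realType) (X Y : emetricSpace R) (e : R)
    (eta : X -> Y) :
  (0 <= e)%R -> eps_isometric_embedding e eta ->
  exists kappa : Lip Y -> Lip X,
    forall (f : Lip Y) x, absdiff (kappa f x) (f (eta x)) <= e%:E.
Proof.
move=> e0 eta_emb.
exists (fun f => lip_envelope (fun x => lip_ge0 f (eta x))) => f.
apply: lip_envelope_near => // x x'.
have /absdiff_leP[] := eta_emb x x';
  rewrite ?emetric_ge0 ?lee_fin // => _ eta_le.
by apply: le_trans (lip_le f _ (eta x')) _; rewrite -addeA leeD2l.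
Qed.

Theorem theorem1 (R : realType) (X Y : emetricSpace R) (eps : R)
    (eps_ge0 : (0 <= eps)%R) (eta : X -> Y) (eta' : Y -> X)
    (eta_iso : eps_isometry eps eta eta') :
  exists (kappa : Lip Y -> Lip X) (kappa' : Lip X -> Lip Y),
    eps_ml_isomorphism (4 * eps)%R kappa kappa' /\
    forall f : Lip Y,
      ereal_sup (range (fun x : X => absdiff (kappa f x) (f (eta x)))) <= eps%:E.
Proof.
case: eta_iso => eta_emb eta'_emb etaK eta'K.
have [kappa kappa_near] := exists_lip_near_precomp eps_ge0 eta_emb.
have [kappa' kappa'_near] := exists_lip_near_precomp eps_ge0 eta'_emb.
exists kappa, kappa'; split; last first.
  by move=> f; apply: ge_ereal_sup => _ [x _ <-].
split.
- exact: near_precomp_ml_homomorphism etaK kappa_near.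
- exact: near_precomp_ml_homomorphism eta'K kappa'_near.
- exact: near_precomp_cancel eta'K kappa'_near _ kappa_near.
- exact: near_precomp_cancel etaK kappa_near _ kappa'_near.
Qed.
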